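(* Let $\mathbb{M}$ be one of $\mathsf{K},\mathsf{D},\mathsf{T},\mathsf{K4},\mathsf{S4}$. If $\Pi$ is a proof in the 2-sequent calculus $2_{\mathbb{M}}$ of a 2-sequent $\Gamma\vdash\Delta$, then there exists a cut-free $2_{\mathbb{M}}$-proof $\Pi^*$ of $\Gamma\vdash\Delta$.
   Context: Modal formulas are built from countably many proposition symbols $p_0,p_1,\dots$ using $\neg,\wedge,\vee,\to$ and the unary modal operators $\Box,\Diamond$. Fix a countably infinite set $\mathcal T$ of tokens. A position is a finite (possibly empty) sequence of tokens; $\langle\,\rangle$ is the empty sequence, $\alpha\circ\beta$ is concatenation, and $\alpha\circ x$ abbreviates $\alpha\circ\langle x\rangle$ for a token $x$. Write $\beta\preceq\alpha$ if $\beta$ is a prefix of $\alpha$. A p-formula is an expression $A^{\alpha}$ with $A$ a modal formula and $\alpha$ a position. A 2-sequent is $\Gamma\vdash\Delta$ with $\Gamma,\Delta$ finite (possibly empty) sequences of p-formulas. For a sequence $\Gamma$ of p-formulas, $I(\Gamma)=\{\beta:\exists A^{\alpha}\in\Gamma,\ \beta\preceq\alpha\}$. The calculus $2_{\mathsf{S4}}$ has the rules (all sequences may be empty): Axiom $A^\alpha\vdash A^\alpha$; Cut: from $\Gamma_1\vdash A^\alpha,\Delta_1$ and $\Gamma_2,A^\alpha\vdash\Delta_2$ infer $\Gamma_1,\Gamma_2\vdash\Delta_1,\Delta_2$; weakening, contraction and exchange on both sides; propositional rules, in which all active p-formulas carry the same position $\alpha$: from $\Gamma\vdash A^\alpha,\Delta$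 infer $\Gamma,(\neg A)^\alpha\vdash\Delta$; from $\Gamma,A^\alpha\vdash\Delta$ infer $\Gamma\vdash(\neg A)^\alpha,\Delta$; from $\Gamma,A^\alpha\vdash\Delta$ (or $\Gamma,B^\alpha\vdash\Delta$) infer $\Gamma,(A\wedge B)^\alpha\vdash\Delta$; from $\Gamma_1\vdash A^\alpha,\Delta_1$ and $\Gamma_2\vdash B^\alpha,\Delta_2$ infer $\Gamma_1,\Gamma_2\vdash(A\wedge B)^\alpha,\Delta_1,\Delta_2$; from $\Gamma_1,A^\alpha\vdash\Delta_1$ and $\Gamma_2,B^\alpha\vdash\Delta_2$ infer $\Gamma_1,\Gamma_2,(A\vee B)^\alpha\vdash\Delta_1,\Delta_2$; from $\Gamma\vdash A^\alpha,\Delta$ (or $\Gamma\vdash B^\alpha,\Delta$) infer $\Gamma\vdash(A\vee B)^\alpha,\Delta$; from $\Gamma_1,B^\alpha\vdash\Delta_1$ and $\Gamma_2\vdash A^\alpha,\Delta_2$ infer $\Gamma_1,\Gamma_2,(A\to B)^\alpha\vdash\Delta_1,\Delta_2$; from $\Gamma,A^\alpha\vdash B^\alpha,\Delta$ infer $\Gamma\vdash(A\to B)^\alpha,\Delta$. Modal rules: ($\Box\vdash$) from $\Gamma,A^{\alpha\circ\beta}\vdash\Delta$ infer $\Gamma,(\Box A)^\alpha\vdash\Delta$; ($\vdash\Box$) from $\Gamma\vdash A^{\alpha\circ x},\Delta$ infer $\Gamma\vdash(\Box A)^\alpha,\Delta$; ($\Diamond\vdash$) from $\Gamma,A^{\alpha\circ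 x}\vdash\Delta$ infer $\Gamma,(\Diamond A)^\alpha\vdash\Delta$; ($\vdash\Diamond$) from $\Gamma\vdash A^{\alpha\circ\beta},\Delta$ infer $\Gamma\vdash(\Diamond A)^\alpha,\Delta$; here $\beta$ is a position, $x$ a token, and in $\vdash\Box$ and $\Diamond\vdash$ it is required that $\alpha\circ x\notin I(\Gamma,\Delta)$. The calculi $2_{\mathsf T},2_{\mathsf D},2_{\mathsf{K4}},2_{\mathsf K}$ have the same rules with extra constraints on $\Box\vdash$ and $\vdash\Diamond$: in $2_{\mathsf T}$, $\beta$ is empty or a single token; in $2_{\mathsf D}$, $\beta$ is a single token; in $2_{\mathsf{K4}}$, $\beta$ is nonempty and $\Gamma$ or $\Delta$ contains a p-formula $B^{\alpha\circ\beta\circ\eta}$ for some formula $B$ and position $\eta$; in $2_{\mathsf K}$, $\beta$ is a single token and $\Gamma$ or $\Delta$ contains a p-formula $B^{\alpha\circ\beta\circ\eta}$. Moreover in $2_{\mathsf K}$ and $2_{\mathsf{K4}}$ the Cut rule may only be applied when $\alpha\in I(\Gamma_1,\Delta_1)$ or $\alpha\in I(\Gamma_2,\Delta_2)$. A proof is cut-free if it contains no application of Cut. *)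

(* Defs.v *)
From Stdlib Require Export List.
Export ListNotations.

(* Proposition symbols p_0, p_1, ... are represented by their indices. *)
Inductive formula : Type :=
| Var (n : nat)
| Neg (A : formula)
| And (A B : formula)
| Or (A B : formula)
| Imp (A B : formula)
| Box (A : formula)
| Dia (A : formula).

(* The countably infinite set of tokens is taken to be nat. *)
Definition token : Type := nat.
Definition position : Type := list token.

Definition is_prefix (b a : position) : Prop := exists eta, a = b ++ eta.

Record pformula : Type := PF { form : formula; pos : position }.

Notation "A ^^ a" := (PF A a) (at level 30, right associativity).

(* [In_I b G] is the membership of b in I(G). *)
Definition In_I (b : position) (G : list pformula) : Prop :=
  exists A a, In (A ^^ a) G /\ is_prefix b a.

Inductive logic : Type := LK | LD | LT | LK4 | LS4.

Definition single_token (b : position) : Prop := exists x : token, b = [x].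

(* Constraint on the rules (Box |-) and (|- Dia), where the active formula
   moves from a ++ b to a and G, D are the side sequences.  In K and K4 the
   witness has to be found among the side p-formulas: the active p-formula
   itself does not count. *)
Definition modal_side (M : logic) (a b : position) (G D : list pformula)
  : Prop :=
  match M with
  | LS4 => True
  | LT => b = [] \/ single_token b
  | LD => single_token b
  | LK4 => b <> [] /\
          (exists B eta, In (B ^^ (a ++ b ++ eta)) G \/
                         In (B ^^ (a ++ b ++ eta)) D)
  | LK => single_token b /\
          (exists B eta, In (B ^^ (a ++ b ++ eta)) G \/
                         In (B ^^ (a ++ b ++ eta)) D)
  end.

Definition cut_side (M : logic) (a : position) (G1 D1 G2 D2 : list pformula)
  : Prop :=
  match M with
  | LK | LK4 => In_I a (G1 ++ D1) \/ In_I a (G2 ++ D2)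
  | LD | LT | LS4 => True
  end.

(* [proof M G D] is the type of proof trees of the 2-sequent G |- D in the
   calculus 2_M.  It lives in Type so that a proof can be inspected for
   applications of Cut. *)
Inductive proof (M : logic) : list pformula -> list pformula -> Type :=
| Axiom_rule A a :
    proof M [A ^^ a] [A ^^ a]
| Cut_rule A a G1 D1 G2 D2 :
    cut_side M a G1 D1 G2 D2 ->
    proof M G1 (A ^^ a :: D1) -> proof M (G2 ++ [A ^^ a]) D2 ->
    proof M (G1 ++ G2) (D1 ++ D2)
| Weak_l A a G D :
    proof M G D -> proof M (G ++ [A ^^ a]) D
| Weak_r A a G D :
    proof M G D -> proof M G (A ^^ a :: D)
| Contr_l A a G D :
    proof M (G ++ [A ^^ a; A ^^ a]) D -> proof M (G ++ [A ^^ a]) D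
| Contr_r A a G D :
    proof M G (A ^^ a :: A ^^ a :: D) -> proof M G (A ^^ a :: D)
| Exch_l A a B b G1 G2 D :
    proof M (G1 ++ A ^^ a :: B ^^ b :: G2) D ->
    proof M (G1 ++ B ^^ b :: A ^^ a :: G2) D
| Exch_r A a B b G D1 D2 :
    proof M G (D1 ++ A ^^ a :: B ^^ b :: D2) ->
    proof M G (D1 ++ B ^^ b :: A ^^ a :: D2)
| Neg_l A a G D :
    proof M G (A ^^ a :: D) -> proof M (G ++ [Neg A ^^ a]) D
| Neg_r A a G D :
    proof M (G ++ [A ^^ a]) D -> proof M G (Neg A ^^ a :: D)
| And_l1 A B a G D :
    proof M (G ++ [A ^^ a]) D -> proof M (G ++ [And A B ^^ a]) D
| And_l2 A B a G D :
    proof M (G ++ [B ^^ a]) D -> proof M (G ++ [And A B ^^ a]) D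
| And_r A B a G1 D1 G2 D2 :
    proof M G1 (A ^^ a :: D1) -> proof M G2 (B ^^ a :: D2) ->
    proof M (G1 ++ G2) (And A B ^^ a :: D1 ++ D2)
| Or_l A B a G1 D1 G2 D2 :
    proof M (G1 ++ [A ^^ a]) D1 -> proof M (G2 ++ [B ^^ a]) D2 ->
    proof M (G1 ++ G2 ++ [Or A B ^^ a]) (D1 ++ D2)
| Or_r1 A B a G D :
    proof M G (A ^^ a :: D) -> proof M G (Or A B ^^ a :: D)
| Or_r2 A B a G D :
    proof M G (B ^^ a :: D) -> proof M G (Or A B ^^ a :: D)
| Imp_l A B a G1 D1 G2 D2 :
    proof M (G1 ++ [B ^^ a]) D1 -> proof M G2 (A ^^ a :: D2) ->
    proof M (G1 ++ G2 ++ [Imp A B ^^ a]) (D1 ++ D2)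
| Imp_r A B a G D :
    proof M (G ++ [A ^^ a]) (B ^^ a :: D) -> proof M G (Imp A B ^^ a :: D)
| Box_l A a b G D :
    modal_side M a b G D ->
    proof M (G ++ [A ^^ (a ++ b)]) D -> proof M (G ++ [Box A ^^ a]) D
| Box_r A a x G D :
    ~ In_I (a ++ [x]) (G ++ D) ->
    proof M G (A ^^ (a ++ [x]) :: D) -> proof M G (Box A ^^ a :: D)
| Dia_l A a x G D :
    ~ In_I (a ++ [x]) (G ++ D) ->
    proof M (G ++ [A ^^ (a ++ [x])]) D -> proof M (G ++ [Dia A ^^ a]) D
| Dia_r A a b G D :
    modal_side M a b G D ->
    proof M G (A ^^ (a ++ b) :: D) -> proof M G (Dia A ^^ a :: D).

Fixpoint cut_free {M : logic} {G D : list pformula} (P : proof M G D) : Prop :=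
  match P with
  | Axiom_rule _ _ _ => True
  | Cut_rule _ _ _ _ _ _ _ _ _ _ => False
  | Weak_l _ _ _ _ _ P1 => cut_free P1
  | Weak_r _ _ _ _ _ P1 => cut_free P1
  | Contr_l _ _ _ _ _ P1 => cut_free P1
  | Contr_r _ _ _ _ _ P1 => cut_free P1
  | Exch_l _ _ _ _ _ _ _ _ P1 => cut_free P1
  | Exch_r _ _ _ _ _ _ _ _ P1 => cut_free P1
  | Neg_l _ _ _ _ _ P1 => cut_free P1
  | Neg_r _ _ _ _ _ P1 => cut_free P1
  | And_l1 _ _ _ _ _ _ P1 => cut_free P1
  | And_l2 _ _ _ _ _ _ P1 => cut_free P1
  | And_r _ _ _ _ _ _ _ _ P1 P2 => cut_free P1 /\ cut_free P2
  | Or_l _ _ _ _ _ _ _ _ P1 P2 => cut_free P1 /\ cut_free P2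
  | Or_r1 _ _ _ _ _ _ P1 => cut_free P1
  | Or_r2 _ _ _ _ _ _ P1 => cut_free P1
  | Imp_l _ _ _ _ _ _ _ _ P1 P2 => cut_free P1 /\ cut_free P2
  | Imp_r _ _ _ _ _ _ P1 => cut_free P1
  | Box_l _ _ _ _ _ _ _ P1 => cut_free P1
  | Box_r _ _ _ _ _ _ _ P1 => cut_free P1
  | Dia_l _ _ _ _ _ _ _ P1 => cut_free P1
  | Dia_r _ _ _ _ _ _ _ P1 => cut_free P1
  end.

(* Main.v *)
Require Import Defs.
From Stdlib Require Import Arith Lia Permutation Cantor Classical ClassicalEpsilon.

(** The argument is semantic.  A 2-sequent is interpreted in Kripke models
    through a map [h] from positions to worlds that follows the accessibility
    relation; in K and K4 it has to do so only along the positions of [I(G,D)],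
    and the side conditions of Cut, (Box |-) and (|- Dia) say exactly that
    passing to the premises creates no new position.  All rules, Cut included,
    are sound.  Conversely, a sequent without cut-free proof is extended by a
    fair schedule to a saturated pair of sets of p-formulas, none of whose
    finite stages is cut-free provable; the positions themselves are the worlds
    of a countermodel, with [h] the identity. *)

(** * Kripke semantics *)

Fixpoint sat {W : Type} (R : W -> W -> Prop) (V : W -> nat -> Prop)
    (w : W) (A : formula) : Prop :=
  match A with
  | Var n => V w n
  | Neg A => ~ sat R V w A
  | And A B => sat R V w A /\ sat R V w B
  | Or A B => sat R V w A \/ sat R V w B
  | Imp A B => sat R V w A -> sat R V w B
  | Box A => forall v, R w v -> sat R V v A
  | Dia A => exists v, R w v /\ sat R V v A
  end.

(* Seriality is stated with a successor function, so that soundness needs no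
   choice. *)
Definition frame (M : logic) {W : Type} (R : W -> W -> Prop) : Prop :=
  match M with
  | LK => True
  | LD => exists s : W -> W, forall w, R w (s w)
  | LT => forall w, R w w
  | LK4 => forall u v w, R u v -> R v w -> R u w
  | LS4 => (forall w, R w w) /\ (forall u v w, R u v -> R v w -> R u w)
  end.

(** Frames for K and K4 may have dead ends, so a map following [R] at every position need not exist
    there. In D, T and S4 the rules may mention positions outside I(L), so all of them are
    constrained. *)
Definition interpreted (M : logic) (L : list pformula) (a : position) : Prop :=
  match M with
  | LK | LK4 => In_I a L
  | LD | LT | LS4 => True
  end.

Definition follows (M : logic) {W : Type} (R : W -> W -> Prop)
    (h : position -> W) (L : list pformula) : Prop :=
  forall a x, interpreted M L (a ++ [x]) -> R (h a) (h (a ++ [x])).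

Definition psat {W : Type} (R : W -> W -> Prop) (V : W -> nat -> Prop)
    (h : position -> W) (p : pformula) : Prop :=
  sat R V (h (pos p)) (form p).

Definition holds {W : Type} (R : W -> W -> Prop) (V : W -> nat -> Prop)
    (h : position -> W) (G D : list pformula) : Prop :=
  Forall (psat R V h) G -> Exists (psat R V h) D.

Definition valid (M : logic) (G D : list pformula) : Prop :=
  forall (W : Type) (R : W -> W -> Prop) (V : W -> nat -> Prop)
    (h : position -> W),
    frame M R -> follows M R h (G ++ D) -> holds R V h G D.

Lemma In_I_spec b L :
  In_I b L <-> exists p, In p L /\ is_prefix b (pos p).
Proof.
  split.
  - intros (A & a & H & Hp). exists (A ^^ a). auto.
  - intros ([A a] & H & Hp). exists A, a. auto.
Qed.

Lemma In_I_pos p L : In p L -> In_I (pos p) L.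
Proof.
  intros H. apply In_I_spec. exists p. split; [exact H|].
  exists []. symmetry; apply app_nil_r.
Qed.

Lemma In_I_map_pos b L : In b (map pos L) -> In_I b L.
Proof. intros H. apply in_map_iff in H as (p & <- & H). now apply In_I_pos. Qed.

Lemma In_I_app_prefix a b L : In_I (a ++ b) L -> In_I a L.
Proof.
  intros (A & c & H & e & ->). exists A, (a ++ b ++ e). split.
  - now rewrite !app_assoc in *.
  - now exists (b ++ e).
Qed.

Lemma In_I_covered L L' :
  (forall p, In p L -> In_I (pos p) L') -> forall b, In_I b L -> In_I b L'.
Proof.
  intros H b (A & a & Hin & e & ->). apply H in Hin; cbn in Hin.
  exact (In_I_app_prefix _ _ _ Hin).
Qed.

Lemma In_I_incl L L' b : incl L L' -> In_I b L -> In_I b L'.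
Proof. intros H. apply In_I_covered. intros p Hp. now apply In_I_pos, H. Qed.

Lemma follows_covered M W (R : W -> W -> Prop) h L L' :
  (M = LK \/ M = LK4 -> forall p, In p L' -> In_I (pos p) L) ->
  follows M R h L -> follows M R h L'.
Proof.
  intros H F a x Hi. apply F.
  destruct M; cbn in *; auto; eapply In_I_covered; eauto.
Qed.

Lemma modal_side_In_I M a b G D :
  M = LK \/ M = LK4 -> modal_side M a b G D -> In_I (a ++ b) (G ++ D).
Proof.
  intros HM Hs.
  assert (exists B eta, In (B ^^ (a ++ b ++ eta)) G \/
                        In (B ^^ (a ++ b ++ eta)) D) as (B & e & H)
    by (destruct HM; subst; apply Hs).
  exists B, (a ++ b ++ e). split; [now apply in_or_app|].
  exists e. now rewrite app_assoc.
Qed.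

(** The path from [a] to [a ++ b] is climbed token by token. Since I(L) is closed under prefixes, an
    interpreted endpoint makes every intermediate position interpreted. *)
Lemma follows_trans_path M W (R : W -> W -> Prop) h L b :
  (forall u v w, R u v -> R v w -> R u w) -> follows M R h L ->
  b <> [] -> forall a, interpreted M L (a ++ b) -> R (h a) (h (a ++ b)).
Proof.
  intros T F. induction b as [|x b IH] using rev_ind; [easy|].
  intros _ a Hi. rewrite app_assoc in *.
  destruct b as [|y b].
  - rewrite app_nil_r in *. now apply F.
  - apply T with (h (a ++ y :: b)).
    + apply IH; [easy|]. destruct M; cbn in *; auto;
        eapply In_I_app_prefix; eassumption.
    + now apply F.
Qed.

(** A single token is one edge, an empty [b] is covered by reflexivity and a longer one by
    transitivity. In K and K4 the required side p-formula makes the endpoint interpreted. *)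
Lemma modal_side_accessible M W (R : W -> W -> Prop) h a b G D L :
  frame M R -> follows M R h L -> incl (G ++ D) L ->
  modal_side M a b G D -> R (h a) (h (a ++ b)).
Proof.
  intros Fr F I Hs.
  assert (Hi : interpreted M L (a ++ b)).
  { assert (HM : M = LK \/ M = LK4 -> In_I (a ++ b) L).
    { intros HM. apply (In_I_incl _ _ _ I). now apply (modal_side_In_I M). }
    destruct M; cbn; auto. }
  destruct M; cbn in Fr, Hs.
  - destruct Hs as [[x ->] _]. now apply F.
  - destruct Hs as [x ->]. now apply F.
  - destruct Hs as [->|[x ->]]; [rewrite app_nil_r; apply Fr|now apply F].
  - destruct Hs as [Hb _]. eapply follows_trans_path; eauto.
  - destruct b as [|y b]; [rewrite app_nil_r; apply Fr|].
    eapply follows_trans_path; eauto; try apply Fr; easy.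
Qed.

(** * Soundness of the eigenposition rules *)

Fixpoint strip (c b : position) : option position :=
  match c, b with
  | [], _ => Some b
  | x :: c, y :: b => if Nat.eq_dec x y then strip c b else None
  | _ :: _, [] => None
  end.

Lemma strip_app c e : strip c (c ++ e) = Some e.
Proof. induction c; cbn; auto. now destruct Nat.eq_dec. Qed.

Lemma strip_Some c b e : strip c b = Some e -> b = c ++ e.
Proof.
  revert b; induction c as [|x c IH]; intros b; cbn.
  - now intros [= ->].
  - destruct b as [|y b]; [easy|]. destruct Nat.eq_dec as [->|]; [|easy].
    intros H. now rewrite (IH _ H).
Qed.

(* Reroutes the whole subtree below the eigenposition [c] to [w]; below [c] the
   path continues along the successor function [s]. *)
Definition reroute {W : Type} (h : position -> W) (c : position)
    (w : W) (s : W -> W) (b : position) : W :=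
  match strip c b with
  | Some e => Nat.iter (length e) s w
  | None => h b
  end.

Lemma reroute_at W (h : position -> W) c w s : reroute h c w s c = w.
Proof.
  unfold reroute. rewrite <- (app_nil_r c) at 2. now rewrite strip_app.
Qed.

Lemma reroute_off W (h : position -> W) c w s b :
  ~ is_prefix c b -> reroute h c w s b = h b.
Proof.
  intros H. unfold reroute. destruct (strip c b) as [e|] eqn:E; [|easy].
  destruct H. exists e. now apply strip_Some.
Qed.

Lemma not_is_prefix_snoc (a : position) x : ~ is_prefix (a ++ [x]) a.
Proof.
  intros [e H]. apply (f_equal (@length _)) in H.
  rewrite !length_app in H; cbn in H; lia.
Qed.

(** Under reflexivity the identity serves as successor function; in K and K4 it is only a default
    value. *)
Lemma frame_successor M W (R : W -> W -> Prop) :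
  frame M R -> exists s : W -> W, M = LK \/ M = LK4 \/ forall w, R w (s w).
Proof.
  destruct M; cbn; intros Fr.
  - exists (fun w => w). auto.
  - destruct Fr as [s Hs]. exists s. auto.
  - exists (fun w => w). auto.
  - exists (fun w => w). auto.
  - exists (fun w => w). right; right. apply Fr.
Qed.

Lemma is_prefix_snoc_inv (b a : position) x :
  is_prefix b (a ++ [x]) -> b = a ++ [x] \/ is_prefix b a.
Proof.
  intros [e He]. destruct e as [|y e] using rev_ind.
  - left. now rewrite app_nil_r in He.
  - right. rewrite app_assoc in He. apply app_inj_tail in He as [-> _].
    now exists e.
Qed.

Lemma In_I_cons b A a L :
  In_I b (A ^^ a :: L) <-> is_prefix b a \/ In_I b L.
Proof.
  rewrite !In_I_spec. split.
  - intros (p & [<-|Hp] & H); [now left|right; eauto].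
  - intros [H|(p & Hp & H)]; [exists (A ^^ a)|exists p]; cbn; auto.
Qed.

(** Edges off the subtree at [a ++ [x]] are unchanged, the edge into its root becomes [R (h a) w],
    and edges inside it follow [s]. In K and K4 the inner edges are not interpreted, because [a ++
    [x]] is fresh for [L]. *)
Lemma follows_reroute M W (R : W -> W -> Prop) h s A B a x w L :
  (M = LK \/ M = LK4 \/ forall w, R w (s w)) ->
  ~ In_I (a ++ [x]) L -> R (h a) w -> follows M R h (B ^^ a :: L) ->
  follows M R (reroute h (a ++ [x]) w s) (A ^^ (a ++ [x]) :: L).
Proof.
  intros Hs Hx Hw F b y Hi.
  destruct (classic (is_prefix (a ++ [x]) (b ++ [y]))) as [[e He]|Hn].
  - destruct e as [|z e _] using rev_ind.
    + rewrite app_nil_r in He. apply app_inj_tail in He as [-> ->].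
      rewrite reroute_at, reroute_off by apply not_is_prefix_snoc. exact Hw.
    + rewrite app_assoc in He. apply app_inj_tail in He as [-> ->].
      assert (Hnot : ~ In_I (((a ++ [x]) ++ e) ++ [z])
                        (A ^^ (a ++ [x]) :: L)).
      { rewrite In_I_cons. intros [[f Hf]|Hf].
        - apply (f_equal (@length _)) in Hf.
          rewrite !length_app in Hf; cbn in Hf; lia.
        - apply Hx. do 2 apply In_I_app_prefix in Hf. exact Hf. }
      destruct Hs as [->|[->|Hs]]; [easy|easy|].
      unfold reroute. rewrite <- (app_assoc _ e), !strip_app.
      rewrite length_app, Nat.add_comm. apply Hs.
  - assert (~ is_prefix (a ++ [x]) b).
    { intros [e ->]. apply Hn. exists (e ++ [y]). now rewrite !app_assoc. }
    rewrite !reroute_off by assumption. apply F.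
    assert (Hin : In_I (b ++ [y]) (A ^^ (a ++ [x]) :: L) ->
                  In_I (b ++ [y]) (B ^^ a :: L)).
    { rewrite !In_I_cons. intros [Hp|]; [|now right].
      apply is_prefix_snoc_inv in Hp as [E|]; [|now left].
      destruct Hn. exists []. now rewrite app_nil_r. }
    destruct M; cbn in *; auto.
Qed.

Lemma psat_reroute W (R : W -> W -> Prop) V h c w s p L :
  ~ In_I c L -> In p L ->
  psat R V (reroute h c w s) p <-> psat R V h p.
Proof.
  intros Hc Hp. unfold psat. rewrite reroute_off; [easy|].
  intros H. apply Hc, In_I_spec. eauto.
Qed.

Lemma holds_reroute W (R : W -> W -> Prop) V h c w s G D :
  ~ In_I c (G ++ D) ->
  (Forall (psat R V (reroute h c w s)) G <-> Forall (psat R V h) G) /\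
  (Exists (psat R V (reroute h c w s)) D <-> Exists (psat R V h) D).
Proof.
  intros Hc. rewrite !Forall_forall, !Exists_exists.
  assert (H : forall p, In p (G ++ D) ->
                psat R V (reroute h c w s) p <-> psat R V h p)
    by (intros p; now apply psat_reroute).
  setoid_rewrite in_app_iff in H. firstorder.
Qed.

(** * Soundness *)

(** This serves the rules without an eigenposition: their premises are evaluated under the same [h]
    as the conclusion, which leaves propositional reasoning or a single modal step. *)
Lemma valid_step M G D G' D' :
  (M = LK \/ M = LK4 ->
   forall p, In p (G' ++ D') -> In_I (pos p) (G ++ D)) ->
  valid M G' D' ->
  forall (W : Type) (R : W -> W -> Prop) V h,
    frame M R -> follows M R h (G ++ D) -> holds R V h G' D'.
Proof.
  intros H Hv W R V h Fr F. apply Hv; [exact Fr|].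
  eapply follows_covered; eauto.
Qed.

(* Every position of a premise of a propositional or structural rule is the
   position of some p-formula of the conclusion. *)
Ltac same_positions :=
  intros _ p Hp; apply In_I_map_pos;
  apply (in_map pos) in Hp; revert Hp;
  repeat (rewrite ?map_app, ?in_app_iff; cbn [map In pos]); tauto.

Ltac unfold_holds :=
  unfold holds in *;
  repeat rewrite ?Forall_app, ?Forall_cons_iff, ?Forall_nil_iff,
    ?Exists_app, ?Exists_cons, ?Exists_nil in *;
  unfold psat in *; cbn [sat form pos] in *.

(** The right rules for negation and implication are sound only classically; the fallback decides
    the truth of an active formula. *)
Ltac premises :=
  repeat match goal with
  | IH : valid ?M ?G' ?D', Fr : frame ?M ?R, F : follows ?M ?R ?h _
    |- holds ?R ?V ?h ?G ?D =>
      assert (holds R V h G' D')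
        by (refine (valid_step M G D G' D' _ IH _ R V h Fr F); same_positions);
      clear IH
  end;
  unfold_holds;
  first [tauto
        |match goal with A : formula, a : position |- _ =>
           destruct (classic (sat _ _ (_ a) A)); tauto end].

Lemma soundness M G D : proof M G D -> valid M G D.
Proof.
  induction 1; intros W R V h Fr F.
  - unfold_holds. tauto.
  (* The side condition of Cut places the cut position in I of the conclusion. *)
  - assert (C : M = LK \/ M = LK4 -> In_I a ((G1 ++ G2) ++ D1 ++ D2)).
    { intros HM. assert (Hc : In_I a (G1 ++ D1) \/ In_I a (G2 ++ D2))
        by (destruct HM; now subst).
      destruct Hc as [Hc|Hc]; eapply In_I_incl; eauto;
        intros p; rewrite !in_app_iff; tauto. }
    assert (H1 : holds R V h G1 (A ^^ a :: D1)).
    { eapply valid_step; eauto. intros HM p.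
      rewrite in_app_iff; cbn. intros [Hp|[<-|Hp]]; [|now apply C|];
        apply In_I_pos; rewrite !in_app_iff; tauto. }
    assert (H2 : holds R V h (G2 ++ [A ^^ a]) D2).
    { eapply valid_step; eauto. intros HM p.
      rewrite !in_app_iff; cbn. intros [[Hp|[<-|[]]]|Hp]; [|now apply C|];
        apply In_I_pos; rewrite !in_app_iff; tauto. }
    unfold_holds. tauto.
  - premises.
  - premises.
  - premises.
  - premises.
  - premises.
  - premises.
  - premises.
  - premises.
  - premises.
  - premises.
  - premises.
  - premises.
  - premises.
  - premises.
  - premises.
  - premises.
  - assert (H1 : holds R V h (G ++ [A ^^ (a ++ b)]) D).
    { eapply valid_step; eauto. intros HM p.
      rewrite !in_app_iff; cbn. intros [[Hp|[<-|[]]]|Hp];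
        [| apply (In_I_incl (G ++ D)); [|now apply (modal_side_In_I M)];
           intros q; rewrite !in_app_iff; tauto |];
        apply In_I_pos; rewrite !in_app_iff; tauto. }
    assert (R (h a) (h (a ++ b))).
    { eapply modal_side_accessible; eauto.
      intros p; rewrite !in_app_iff; tauto. }
    unfold_holds. intros [HG [HA _]]. auto.
  (* If no formula of [D] holds, take any successor [w] of [h a] and reroute the eigenposition to
     it. The side formulas keep their truth values, so the premise forces [A] at [w]. *)
  - destruct (classic (Exists (psat R V h) D)) as [|HD];
      [intros _; now right|].
    intros HG. left. cbn. intros w Hw.
    destruct (frame_successor M W R Fr) as [s Hs].
    destruct (holds_reroute W R V h (a ++ [x]) w s G D n) as [EG ED].
    assert (H1 : holds R V (reroute h (a ++ [x]) w s) G (A ^^ (a ++ [x]) :: D)).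
    { apply IHX; [exact Fr|].
      eapply follows_covered; [|eapply (follows_reroute M W R h s A (Box A));
        eauto; eapply follows_covered; [|exact F]];
      intros HM p; cbn; rewrite !in_app_iff; cbn; intros Hp;
        apply In_I_pos; cbn; rewrite !in_app_iff; cbn; tauto. }
    apply EG, H1 in HG. apply Exists_cons in HG as [HA|HA].
    + unfold psat in HA; cbn in HA. now rewrite reroute_at in HA.
    + now apply ED in HA.
  - intros HG. apply Forall_app in HG as [HG HA].
    apply Forall_inv in HA. destruct HA as [w [Hw HA]].
    (* Dually, the eigenposition is sent to the world [w] that witnesses [Dia A]. *)
    destruct (frame_successor M W R Fr) as [s Hs].
    destruct (holds_reroute W R V h (a ++ [x]) w s G D n) as [EG ED].
    assert (H1 : holds R V (reroute h (a ++ [x]) w s)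
                   (G ++ [A ^^ (a ++ [x])]) D).
    { apply IHX; [exact Fr|].
      eapply follows_covered; [|eapply (follows_reroute M W R h s A (Dia A));
        eauto; eapply follows_covered; [|exact F]];
      intros HM p; cbn; rewrite !in_app_iff; cbn; intros Hp;
        apply In_I_pos; cbn; rewrite !in_app_iff; cbn; tauto. }
    apply ED, H1, Forall_app. split; [now apply EG|].
    constructor; [|constructor]. unfold psat; cbn. now rewrite reroute_at.
  - assert (H1 : holds R V h G (A ^^ (a ++ b) :: D)).
    { eapply valid_step; eauto. intros HM p.
      rewrite !in_app_iff; cbn. intros [Hp|[<-|Hp]];
        [| apply (In_I_incl (G ++ D)); [|now apply (modal_side_In_I M)];
           intros q; rewrite !in_app_iff; cbn; tauto |];
        apply In_I_pos; rewrite !in_app_iff; cbn; tauto. }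
    assert (R (h a) (h (a ++ b))).
    { eapply modal_side_accessible; eauto.
      intros p; rewrite !in_app_iff; cbn; tauto. }
    unfold_holds. intros HG. destruct (H1 HG); eauto.
Qed.

(** * The cut-free calculus modulo structural rules *)

Definition cf (M : logic) (G D : list pformula) : Prop :=
  exists P : proof M G D, cut_free P.

(** Weaken by all of [l'], then contract each element of [l] with its occurrence in [l']. Exchange
    first brings the two copies to the head, where contraction acts. *)
Lemma incl_closed {A} (Q : list A -> Prop) :
  (forall x y l1 l2, Q (l1 ++ x :: y :: l2) -> Q (l1 ++ y :: x :: l2)) ->
  (forall x l, Q l -> Q (x :: l)) ->
  (forall x l, Q (x :: x :: l) -> Q (x :: l)) ->
  forall l l', incl l l' -> Q l -> Q l'.
Proof.
  intros exch weak contr.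
  assert (perm : forall l l', Permutation l l' ->
            forall l0, Q (l0 ++ l) -> Q (l0 ++ l')).
  { induction 1; intros l0 Hq; auto.
    specialize (IHPermutation (l0 ++ [x])).
    rewrite <- !app_assoc in IHPermutation. auto. }
  assert (absorb : forall l l', incl l l' -> Q (l ++ l') -> Q l').
  { induction l as [|x l IH]; intros l' Hi Hq; [exact Hq|].
    apply incl_cons_inv in Hi as [Hx Hi]. apply IH; [exact Hi|].
    destruct (in_split _ _ Hx) as (l1 & l2 & ->).
    assert (E : Permutation (l ++ l1 ++ x :: l2) (x :: (l ++ l1) ++ l2))
      by (rewrite app_assoc; symmetry; apply Permutation_middle).
    apply (perm _ _ (Permutation_sym E) []), contr.
    exact (perm _ _ (perm_skip x E) [] Hq). }
  intros l l' Hi Hq. apply (absorb l l' Hi).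
  apply (perm (l' ++ l) _ (Permutation_app_comm _ _) []). cbn.
  induction l' as [|x l' IH] in |- *; cbn; auto.
Qed.

Lemma cf_incl M G D G' D' : incl G G' -> incl D D' -> cf M G D -> cf M G' D'.
Proof.
  intros HG HD H.
  assert (Hr : cf M G D').
  { revert HD H. apply incl_closed.
    - intros [A a] [B b] l1 l2 [P HP]. now exists (Exch_r M A a B b _ _ _ P).
    - intros [A a] l [P HP]. now exists (Weak_r M A a _ _ P).
    - intros [A a] l [P HP]. now exists (Contr_r M A a _ _ P). }
  clear H.
  (* The rules act at the right end of the antecedent. *)
  rewrite <- (rev_involutive G) in Hr. rewrite <- (rev_involutive G').
  revert Hr. apply (incl_closed (fun l => cf M (rev l) D')).
  - intros [A a] [B b] l1 l2. rewrite !rev_app_distr; cbn.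
    rewrite <- !app_assoc; cbn. intros [P HP].
    now exists (Exch_l M _ _ _ _ _ _ _ P).
  - intros [A a] l [P HP]. now exists (Weak_l M A a _ _ P).
  - intros [A a] l; cbn. rewrite <- app_assoc. intros [P HP].
    now exists (Contr_l M A a _ _ P).
  - intros p. rewrite <- !in_rev. apply HG.
Qed.

Ltac solve_incl :=
  intros q; repeat (rewrite ?in_app_iff; cbn [In]); intuition (subst; auto).

Lemma cf_snoc M p G D : cf M (p :: G) D -> cf M (G ++ [p]) D.
Proof. apply cf_incl; solve_incl. Qed.

(** The rules are recast for backward search: the principal p-formula stays in the sequent and two
    premises share their context. [cf_incl] absorbs the extra copies that the original rule leaves
    in its conclusion. *)
Ltac by_rule r :=
  intros;
  repeat match goal with
  | H : cf _ (_ :: _) _ |- _ => apply cf_snoc in H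
  end;
  repeat match goal with
  | H : cf _ _ _ |- _ => destruct H
  end;
  eapply cf_incl;
  [..|unshelve eexists; [eapply r; eassumption|cbn; auto]]; solve_incl.

Lemma cf_axiom M A a G D : In (A ^^ a) G -> In (A ^^ a) D -> cf M G D.
Proof. by_rule (Axiom_rule M A a). Qed.

Lemma cf_neg_l M A a G D :
  In (Neg A ^^ a) G -> cf M G (A ^^ a :: D) -> cf M G D.
Proof. by_rule (Neg_l M A a). Qed.

Lemma cf_neg_r M A a G D :
  In (Neg A ^^ a) D -> cf M (A ^^ a :: G) D -> cf M G D.
Proof. by_rule (Neg_r M A a). Qed.

Lemma cf_and_l1 M A B a G D :
  In (And A B ^^ a) G -> cf M (A ^^ a :: G) D -> cf M G D.
Proof. by_rule (And_l1 M A B a). Qed.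

Lemma cf_and_l2 M A B a G D :
  In (And A B ^^ a) G -> cf M (B ^^ a :: G) D -> cf M G D.
Proof. by_rule (And_l2 M A B a). Qed.

Lemma cf_and_r M A B a G D :
  In (And A B ^^ a) D ->
  cf M G (A ^^ a :: D) -> cf M G (B ^^ a :: D) -> cf M G D.
Proof. by_rule (And_r M A B a). Qed.

Lemma cf_or_l M A B a G D :
  In (Or A B ^^ a) G ->
  cf M (A ^^ a :: G) D -> cf M (B ^^ a :: G) D -> cf M G D.
Proof. by_rule (Or_l M A B a). Qed.

Lemma cf_or_r1 M A B a G D :
  In (Or A B ^^ a) D -> cf M G (A ^^ a :: D) -> cf M G D.
Proof. by_rule (Or_r1 M A B a). Qed.

Lemma cf_or_r2 M A B a G D :
  In (Or A B ^^ a) D -> cf M G (B ^^ a :: D) -> cf M G D.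
Proof. by_rule (Or_r2 M A B a). Qed.

Lemma cf_imp_l M A B a G D :
  In (Imp A B ^^ a) G ->
  cf M (B ^^ a :: G) D -> cf M G (A ^^ a :: D) -> cf M G D.
Proof. by_rule (Imp_l M A B a). Qed.

Lemma cf_imp_r M A B a G D :
  In (Imp A B ^^ a) D -> cf M (A ^^ a :: G) (B ^^ a :: D) -> cf M G D.
Proof. by_rule (Imp_r M A B a). Qed.

Lemma cf_box_l M A a b G D :
  In (Box A ^^ a) G -> modal_side M a b G D ->
  cf M (A ^^ (a ++ b) :: G) D -> cf M G D.
Proof. by_rule (Box_l M A a b). Qed.

Lemma cf_box_r M A a x G D :
  In (Box A ^^ a) D -> ~ In_I (a ++ [x]) (G ++ D) ->
  cf M G (A ^^ (a ++ [x]) :: D) -> cf M G D.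
Proof. by_rule (Box_r M A a x). Qed.

Lemma cf_dia_l M A a x G D :
  In (Dia A ^^ a) G -> ~ In_I (a ++ [x]) (G ++ D) ->
  cf M (A ^^ (a ++ [x]) :: G) D -> cf M G D.
Proof. by_rule (Dia_l M A a x). Qed.

Lemma cf_dia_r M A a b G D :
  In (Dia A ^^ a) D -> modal_side M a b G D ->
  cf M G (A ^^ (a ++ b) :: D) -> cf M G D.
Proof. by_rule (Dia_r M A a b). Qed.

Lemma fresh_token a L : exists x, ~ In_I (a ++ [x]) L.
Proof.
  (* This token exceeds every token occurring in a position of [L]. *)
  exists (S (list_max (concat (map pos L)))). intros (A & c & Hin & e & ->).
  set (m := list_max _) in *.
  assert (Hm : Forall (fun k => k <= m) (concat (map pos L)))
    by now apply list_max_le.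
  rewrite Forall_forall in Hm. enough (S m <= m) by lia.
  apply Hm, in_concat. exists ((a ++ [S m]) ++ e). split.
  - exact (in_map pos _ _ Hin).
  - rewrite !in_app_iff; cbn; auto.
Qed.

(** * Saturation *)

Definition state : Type := list pformula * list pformula.

Definition extends (s s' : state) : Prop :=
  incl (fst s) (fst s') /\ incl (snd s) (snd s').

(** The state [s] is the one before the backward step and [s'] the one after it: side conditions are
    tested in [s], new p-formulas are sought in [s']. *)
Definition expanded_l (M : logic) (A : formula) (a b : position)
    (s s' : state) : Prop :=
  match A with
  | Var _ => True
  | Neg B => In (B ^^ a) (snd s')
  | And B C => In (B ^^ a) (fst s') /\ In (C ^^ a) (fst s')
  | Or B C => In (B ^^ a) (fst s') \/ In (C ^^ a) (fst s')
  | Imp B C => In (B ^^ a) (snd s') \/ In (C ^^ a) (fst s')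
  | Box B => modal_side M a b (fst s) (snd s) -> In (B ^^ (a ++ b)) (fst s')
  | Dia B => exists x, In (B ^^ (a ++ [x])) (fst s')
  end.

Definition expanded_r (M : logic) (A : formula) (a b : position)
    (s s' : state) : Prop :=
  match A with
  | Var _ => True
  | Neg B => In (B ^^ a) (fst s')
  | And B C => In (B ^^ a) (snd s') \/ In (C ^^ a) (snd s')
  | Or B C => In (B ^^ a) (snd s') /\ In (C ^^ a) (snd s')
  | Imp B C => In (B ^^ a) (fst s') /\ In (C ^^ a) (snd s')
  | Box B => exists x, In (B ^^ (a ++ [x])) (snd s')
  | Dia B => modal_side M a b (fst s) (snd s) -> In (B ^^ (a ++ b)) (snd s')
  end.

(* A task asks for one expansion of one p-formula on both sides of the sequent;
   the second position instantiates (Box |-) and (|- Dia). *)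
Definition task : Type := formula * position * position.

Definition performed (M : logic) (t : task) (s s' : state) : Prop :=
  let '(A, a, b) := t in
  (In (A ^^ a) (fst s) -> expanded_l M A a b s s') /\
  (In (A ^^ a) (snd s) -> expanded_r M A a b s s').

Definition unprovable (M : logic) (s : state) : Prop :=
  ~ cf M (fst s) (snd s).

Lemma expand_l M A a b s :
  unprovable M s -> exists s', extends s s' /\ unprovable M s' /\
    (In (A ^^ a) (fst s) -> expanded_l M A a b s s').
Proof.
  intros Hs. apply NNPP; intros N. apply Hs.
  (* Arguing by contradiction, every extension that carries out the expansion is provable. These
     extensions are the premises from which the appropriate rule derives [s] itself. *)
  assert (P : forall G D, incl (fst s) G -> incl (snd s) D ->
            (In (A ^^ a) (fst s) -> expanded_l M A a b s (G, D)) ->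
            cf M G D).
  { intros G D HG HD He. apply NNPP; intros Hn. apply N.
    exists (G, D). repeat split; assumption. }
  clear N. destruct s as [G D]; cbn [fst snd] in *.
  destruct (classic (In (A ^^ a) G)) as [Hin|Hin].
  2: { apply P; [apply incl_refl..|easy]. }
  destruct A; cbn [expanded_l fst snd] in P.
  - apply P; [apply incl_refl..|easy].
  - eapply cf_neg_l; [exact Hin|]. apply P; [solve_incl..|cbn; auto].
  - eapply cf_and_l1; [exact Hin|]. eapply cf_and_l2; [right; exact Hin|].
    apply P; [solve_incl..|cbn; auto].
  - eapply cf_or_l; [exact Hin|..]; (apply P; [solve_incl..|cbn; auto]).
  - eapply cf_imp_l; [exact Hin|..]; (apply P; [solve_incl..|cbn; auto]).
  - destruct (classic (modal_side M a b G D)) as [Hm|Hm].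
    + eapply cf_box_l; [exact Hin|exact Hm|].
      apply P; [solve_incl..|cbn; auto].
    + apply P; [apply incl_refl..|easy].
  - destruct (fresh_token a (G ++ D)) as [x Hx].
    eapply cf_dia_l; [exact Hin|exact Hx|].
    apply P; [solve_incl..|cbn; eauto].
Qed.

Lemma expand_r M A a b s :
  unprovable M s -> exists s', extends s s' /\ unprovable M s' /\
    (In (A ^^ a) (snd s) -> expanded_r M A a b s s').
Proof.
  intros Hs. apply NNPP; intros N. apply Hs.
  assert (P : forall G D, incl (fst s) G -> incl (snd s) D ->
            (In (A ^^ a) (snd s) -> expanded_r M A a b s (G, D)) ->
            cf M G D).
  { intros G D HG HD He. apply NNPP; intros Hn. apply N.
    exists (G, D). repeat split; assumption. }
  clear N. destruct s as [G D]; cbn [fst snd] in *.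
  destruct (classic (In (A ^^ a) D)) as [Hin|Hin].
  2: { apply P; [apply incl_refl..|easy]. }
  destruct A; cbn [expanded_r fst snd] in P.
  - apply P; [apply incl_refl..|easy].
  - eapply cf_neg_r; [exact Hin|]. apply P; [solve_incl..|cbn; auto].
  - eapply cf_and_r; [exact Hin|..]; (apply P; [solve_incl..|cbn; auto]).
  - eapply cf_or_r1; [exact Hin|]. eapply cf_or_r2; [right; exact Hin|].
    apply P; [solve_incl..|cbn; auto].
  - eapply cf_imp_r; [exact Hin|..]; (apply P; [solve_incl..|cbn; auto]).
  - destruct (fresh_token a (G ++ D)) as [x Hx].
    eapply cf_box_r; [exact Hin|exact Hx|].
    apply P; [solve_incl..|cbn; eauto].
  - destruct (classic (modal_side M a b G D)) as [Hm|Hm].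
    + eapply cf_dia_r; [exact Hin|exact Hm|].
      apply P; [solve_incl..|cbn; auto].
    + apply P; [apply incl_refl..|easy].
Qed.

Lemma extends_trans s1 s2 s3 :
  extends s1 s2 -> extends s2 s3 -> extends s1 s3.
Proof. intros [] []. split; eapply incl_tran; eauto. Qed.

Lemma modal_side_extends M a b s s' :
  extends s s' -> modal_side M a b (fst s) (snd s) ->
  modal_side M a b (fst s') (snd s').
Proof.
  intros [HG HD].
  destruct M; cbn; auto; intros [Hb (B & e & H)]; (split; [exact Hb|]);
    exists B, e; (destruct H; [left|right]); auto.
Qed.

Lemma expanded_l_extends M A a b s1 s2 s3 :
  extends s2 s3 -> expanded_l M A a b s1 s2 -> expanded_l M A a b s1 s3.
Proof. intros [HG HD]. destruct A; cbn; firstorder. Qed.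

(** Only the [Dia] clause looks at the earlier state. Its side condition is monotone, so testing it
    in a smaller state asks for less. *)
Lemma expanded_r_advance M A a b s1 s2 s3 :
  extends s1 s2 -> expanded_r M A a b s2 s3 -> expanded_r M A a b s1 s3.
Proof.
  intros H. destruct A; cbn; auto.
  intros He Hm. now apply He, (modal_side_extends M a b s1).
Qed.

(** The left expansion goes first and survives the right one; the right one, tested in the
    intermediate state, also counts from [s]. *)
Lemma perform M t s :
  unprovable M s ->
  exists s', extends s s' /\ unprovable M s' /\ performed M t s s'.
Proof.
  destruct t as [[A a] b]. intros Hs.
  destruct (expand_l M A a b s Hs) as (s1 & E1 & U1 & P1).
  destruct (expand_r M A a b s1 U1) as (s2 & E2 & U2 & P2).
  exists s2. split; [eapply extends_trans; eauto|]. split; [exact U2|].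
  split; intros Hin.
  - eapply expanded_l_extends; eauto.
  - eapply expanded_r_advance; [exact E1|]. now apply P2, E1.
Qed.

(** * Coding of tasks and fair runs *)

Fixpoint list_code (l : list nat) : nat :=
  match l with
  | [] => 0
  | x :: l => S (to_nat (x, list_code l))
  end.

Fixpoint formula_code (A : formula) : nat :=
  match A with
  | Var n => to_nat (0, n)
  | Neg A => to_nat (1, formula_code A)
  | And A B => to_nat (2, to_nat (formula_code A, formula_code B))
  | Or A B => to_nat (3, to_nat (formula_code A, formula_code B))
  | Imp A B => to_nat (4, to_nat (formula_code A, formula_code B))
  | Box A => to_nat (5, formula_code A)
  | Dia A => to_nat (6, formula_code A)
  end.

Definition task_code (t : task) : nat :=
  let '(A, a, b) := t in
  to_nat (formula_code A, to_nat (list_code a, list_code b)).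

Lemma to_nat_eq x y x' y' :
  to_nat (x, y) = to_nat (x', y') -> x = x' /\ y = y'.
Proof.
  intros H. apply (f_equal of_nat) in H. rewrite !cancel_of_to in H.
  now injection H.
Qed.

Ltac decode :=
  repeat match goal with
  | H : to_nat _ = to_nat _ |- _ => apply to_nat_eq in H as [? ?]
  end.

Lemma list_code_inj l l' : list_code l = list_code l' -> l = l'.
Proof.
  revert l'; induction l as [|x l IH]; intros [|y l']; cbn [list_code];
    intros H; try easy.
  apply Nat.succ_inj in H. decode. f_equal; auto.
Qed.

Lemma formula_code_inj A B : formula_code A = formula_code B -> A = B.
Proof.
  revert B; induction A; intros []; cbn [formula_code]; intros H;
    decode; try easy; f_equal; auto.
Qed.

Lemma task_code_inj t t' : task_code t = task_code t' -> t = t'.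
Proof.
  destruct t as [[A a] b], t' as [[A' a'] b']; cbn [task_code]; intros H.
  decode. f_equal; [f_equal|]; auto using formula_code_inj, list_code_inj.
Qed.

(** Stage [to_nat (k, task_code t)] is devoted to [t], whatever [k] is. Hence each task recurs, and
    taking [k = n] gives a stage not below [n]. Stages that code no task get an arbitrary one. *)
Lemma fair_schedule :
  exists sched : nat -> task, forall t n, exists m, n <= m /\ sched m = t.
Proof.
  assert (i : inhabited task) by (constructor; exact (Var 0, [], [])).
  exists (fun m => epsilon i (fun t => exists k, m = to_nat (k, task_code t))).
  intros t n. exists (to_nat (n, task_code t)). split.
  - pose proof (to_nat_non_decreasing n (task_code t)). lia.
  - match goal with |- epsilon i ?P = _ =>
      destruct (epsilon_spec i P (ex_intro _ t (ex_intro _ n eq_refl)))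
        as [k Hk] end.
    apply to_nat_eq in Hk as [_ Hk]. symmetry. now apply task_code_inj.
Qed.

(** The saturated pair is kept as its chain of finite stages, because unprovability and the side
    conditions concern finite sequents. *)
Definition fair_run (M : logic) (s : nat -> state) : Prop :=
  (forall n, unprovable M (s n)) /\
  (forall n m, n <= m -> extends (s n) (s m)) /\
  (forall t n, exists m, n <= m /\ performed M t (s m) (s (S m))).

Lemma fair_run_exists M s0 :
  unprovable M s0 -> exists s, s 0 = s0 /\ fair_run M s.
Proof.
  intros U0. destruct fair_schedule as [sched Hsched].
  (* Working in the subset type carries unprovability along, so that choice yields a total step
     function to iterate. *)
  assert (H : forall t (u : {s | unprovable M s}),
            exists u' : {s | unprovable M s},
            extends (proj1_sig u) (proj1_sig u') /\
            performed M t (proj1_sig u) (proj1_sig u')).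
  { intros t [s Us]. destruct (perform M t s Us) as (s' & E & U & P).
    exists (exist (unprovable M) s' U). auto. }
  pose (next t u := proj1_sig (constructive_indefinite_description _ (H t u))).
  assert (Hnext : forall t u, extends (proj1_sig u) (proj1_sig (next t u)) /\
            performed M t (proj1_sig u) (proj1_sig (next t u)))
    by (intros t u; exact (proj2_sig (constructive_indefinite_description _ (H t u)))).
  pose (run := fix run n := match n with
                            | 0 => exist (unprovable M) s0 U0
                            | S n => next (sched n) (run n)
                            end).
  exists (fun n => proj1_sig (run n)). split; [easy|]. split; [|split].
  - intros n. exact (proj2_sig (run n)).
  - intros n m. induction 1 as [|m _ IH].
    + split; apply incl_refl.
    + eapply extends_trans; [exact IH|]. apply (Hnext (sched m)).
  - intros t n. destruct (Hsched t n) as (m & Hm & <-).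
    exists m. split; [exact Hm|]. apply (Hnext (sched m)).
Qed.

(** * The countermodel *)

(** Accessibility means that (Box |-) and (|- Dia) may move between the two positions at some stage
    of the run. *)
Definition access (M : logic) (s : nat -> state) (a c : position) : Prop :=
  exists b n, c = a ++ b /\ modal_side M a b (fst (s n)) (snd (s n)).

Lemma access_frame M s : frame M (access M s).
Proof.
  (* In K4 the witness for the second step lies below the final position, hence also serves the
     composite step. *)
  assert (T : M = LK4 \/ M = LS4 -> forall u v w,
            access M s u v -> access M s v w -> access M s u w).
  { intros HM u v w (b & n & -> & H) (c & m & -> & H').
    exists (b ++ c), m. split; [now rewrite app_assoc|].
    destruct HM; subst; cbn in *; [|easy].
    destruct H as [Hb _], H' as [_ (B & e & H')].
    split; [now destruct b|]. exists B, e. now rewrite <- !app_assoc in *. }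
  assert (Rf : M = LT \/ M = LS4 -> forall w, access M s w w).
  { intros HM w. exists [], 0. rewrite app_nil_r. split; [easy|].
    destruct HM; subst; cbn; auto. }
  destruct M; cbn; [easy| |now apply Rf; left|now apply T; left|].
  (* In D every one-token step is allowed; token 0 and stage 0 are arbitrary choices. *)
  - exists (fun a => a ++ [0]). intros a. exists [0], 0.
    split; [easy|]. now exists 0.
  - split; [now apply Rf; right|now apply T; right].
Qed.

(** One token meets the length constraint of every logic, and in K and K4 the p-formula that puts [a
    ++ [x]] into I is the required witness. *)
Lemma access_child M s n a x :
  interpreted M (fst (s n) ++ snd (s n)) (a ++ [x]) ->
  access M s a (a ++ [x]).
Proof.
  intros H. exists [x], n. split; [easy|].
  assert (single_token [x]) by now exists x.
  destruct M; cbn in *; auto; (split; [easy|]);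
    destruct H as (B & c & Hin & e & ->); exists B, e;
    rewrite <- app_assoc in Hin; now apply in_app_or.
Qed.

Lemma truth M s A :
  fair_run M s ->
  let V a n := exists k, In (Var n ^^ a) (fst (s k)) in
  forall a,
    (forall n, In (A ^^ a) (fst (s n)) -> sat (access M s) V a A) /\
    (forall n, In (A ^^ a) (snd (s n)) -> ~ sat (access M s) V a A).
Proof.
  intros (U & E & P) V.
  assert (PL : forall B a b n, In (B ^^ a) (fst (s n)) ->
            exists m, n <= m /\ expanded_l M B a b (s m) (s (S m))).
  { intros B a b n Hin. destruct (P (B, a, b) n) as (m & Hm & [H _]).
    exists m. split; [exact Hm|]. now apply H, (E n m Hm). }
  assert (PR : forall B a b n, In (B ^^ a) (snd (s n)) ->
            exists m, n <= m /\ expanded_r M B a b (s m) (s (S m))).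
  { intros B a b n Hin. destruct (P (B, a, b) n) as (m & Hm & [_ H]).
    exists m. split; [exact Hm|]. now apply H, (E n m Hm). }
  assert (C : forall B a x n, In (B ^^ (a ++ [x])) (fst (s n) ++ snd (s n)) ->
            access M s a (a ++ [x])).
  { intros B a x n Hin. apply access_child with n.
    destruct M; cbn; auto; now apply (In_I_pos (B ^^ (a ++ [x]))). }
  induction A as [k|A IH|A IHA B IHB|A IHA B IHB|A IHA B IHB|A IH|A IH];
    intros a; (split; intros n Hin).
  - now exists n.
  (* A variable occurring on both sides would make a common later stage an axiom up to weakening. *)
  - intros [m Hm]. apply (U (max n m)).
    apply cf_axiom with (Var k) a.
    + now apply (E m); [lia|].
    + now apply (E n); [lia|].
  (* Outside (Box |-) and (|- Dia) the second position of the task is the default [[]]. *)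
  - destruct (PL _ _ [] _ Hin) as (m & _ & He). now apply (IH a) in He.
  - destruct (PR _ _ [] _ Hin) as (m & _ & He). apply (IH a) in He. cbn; auto.
  - destruct (PL _ _ [] _ Hin) as (m & _ & [HA HB]).
    split; [now apply IHA in HA|now apply IHB in HB].
  - destruct (PR _ _ [] _ Hin) as (m & _ & [He|He]);
      [apply IHA in He|apply IHB in He]; cbn; tauto.
  - destruct (PL _ _ [] _ Hin) as (m & _ & [He|He]);
      [apply IHA in He|apply IHB in He]; cbn; tauto.
  - destruct (PR _ _ [] _ Hin) as (m & _ & [HA HB]).
    apply IHA in HA; apply IHB in HB; cbn; tauto.
  - destruct (PL _ _ [] _ Hin) as (m & _ & [He|He]);
      [apply IHA in He|apply IHB in He]; cbn; tauto.
  - destruct (PR _ _ [] _ Hin) as (m & _ & [HA HB]).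
    apply IHA in HA; apply IHB in HB; cbn; tauto.
  - intros v (b & k & -> & Hk).
    (* Starting from [max n k] puts the expansion at a stage [m] past [k], where the side condition
       witnessing accessibility still holds. *)
    apply (E n (max n k)) in Hin; [|lia].
    destruct (PL _ _ b _ Hin) as (m & Hm & He).
    apply (IH (a ++ b)) with (S m), He.
    apply (modal_side_extends M a b (s k)); [apply E; lia|exact Hk].
  - destruct (PR _ _ [] _ Hin) as (m & _ & [x He]). intros Hs.
    apply (IH (a ++ [x])) in He as Hn. apply Hn, Hs, (C A a x (S m)).
    apply in_or_app; auto.
  - destruct (PL _ _ [] _ Hin) as (m & _ & [x He]).
    exists (a ++ [x]). split; [|now apply IH in He].
    apply (C A a x (S m)). apply in_or_app; auto.
  - intros (v & (b & k & -> & Hk) & Hs). revert Hs.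
    apply (E n (max n k)) in Hin; [|lia].
    destruct (PR _ _ b _ Hin) as (m & Hm & He).
    apply (IH (a ++ b)) with (S m), He.
    apply (modal_side_extends M a b (s k)); [apply E; lia|exact Hk].
Qed.

(** The run starts at the given sequent, so by [truth] the antecedent is true and the succedent
    false under the identity map. *)
Lemma completeness M G D : valid M G D -> cf M G D.
Proof.
  intros Hv. apply NNPP; intros Hn.
  destruct (fair_run_exists M (G, D) Hn) as (s & H0 & Hs).
  assert (H : holds (access M s)
                (fun a n => exists k, In (Var n ^^ a) (fst (s k)))
                (fun a => a) G D).
  { apply Hv; [apply access_frame|]. intros a x Hi.
    apply access_child with 0. now rewrite H0. }
  unfold holds in H. rewrite Forall_forall, Exists_exists in H.
  destruct H as ([A a] & Hin & Hsat).
  - intros [A a] Hin.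
    apply (truth M s A Hs a) with 0. now rewrite H0.
  - revert Hsat. apply (truth M s A Hs a) with 0. now rewrite H0.
Qed.

Theorem mainTheorem1 (M : logic) (Gamma Delta : list pformula)
    (Pi : proof M Gamma Delta) :
  exists Pi_star : proof M Gamma Delta, cut_free Pi_star.
Proof. apply completeness, soundness, Pi. Qed.
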